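(* Let $M$ be a structure with $T=\mathrm{Th}(M)$ countable, let $G(M)$ be a group definable in $M$, and let a $G(M)$-flow $(X,G(M))$ be given which factors through the action of $G(M)$ on $S_G(M)$ via a continuous surjective $G(M)$-equivariant map $\pi:S_G(M)\to X$. Consider the following three conditions: \begin{enumerate} \item[(i)] $(X,G(M))$ is weakly almost periodic; \item[(ii)] for each continuous function $F:S_G(M)\to\mathbb R$ of the form $f\circ\pi$ with $f:X\to\mathbb R$ continuous, the CL-formula $F(yx)$ is stable in $M$; \item[(iii)] the action of $G(M)$ on $X$ is definable. \end{enumerate} Then: \begin{enumerate} \item[(a)] (i) and (ii) are equivalent, and imply (iii); \item[(b)] if $M$ is $\omega_1$-saturated, then (i), (ii), (iii) are equivalent, and, moreover, in (ii) we have that $F(yx)$ is stable for $T$ (not just in $M$). \end{enumerate}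
   Context: $G(M)$ is treated as a discrete group; a $G(M)$-flow is an action of $G(M)$ by homeomorphisms on a compact Hausdorff space $X$. $S_G(M)$ is the space of complete types over $M$ concentrated on $G$, with the natural left action of $G(M)$. Let $\mathfrak C\succ M$ be a monster model. CL-formulas: for a definable set (sort) $X_0$, a CL-formula on $X_0$ over $M$ is a continuous function $\phi:S_{X_0}(M)\to\mathbb R$; one writes $\phi(b)=\phi(\mathrm{tp}(b/M))$ for $b\in X_0(\mathfrak C)$. For a continuous $F:S_G(M)\to\mathbb R$, $F(yx)$ is the CL-formula over $M$ in the variables $(x,y)$ on $G\times G$ given by $(a,b)\mapsto F(\mathrm{tp}(ba/M))$. A CL-formula $\phi(x,y)$ over $M$ is stable (for $T$) if for all $\epsilon>0$ there do not exist $a_i,b_i$ ($i<\omega$) in $\mathfrak C$ such that $|\phi(a_i,b_j)-\phi(a_j,b_i)|\geq\epsilon$ for all $i<j$; it is stable in $M$ if for all $\epsilon>0$ there do not exist such $a_i,b_i$ in $M$. Weakly almost periodic: for a continuous $f:X\to\mathbb R$ and $g\in G(M)$ put $(gf)(x)=f(gx)$. $f$ is weakly almost periodic if every $h\in\mathbb R^X$ in the closure of $\{gf:g\in G(M)\}$ in the pointwise convergence topology is continuous. The flow $(X,G(M))$ is weakly almost periodic if every continuous $f:X\to\mathbb R$ is weakly almost periodic. Definable action: a function $f$ from $G(M)$ to a compact space $C$ is definable if for all disjoint closed $C_1,C_2\subseteq C$ there is a definable (in $M$) set $Z\subseteq G(M)$ with $f^{-1}(C_1)\subseteq Z$ and $f^{-1}(C_2)\subseteq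 G(M)\setminus Z$; the action on $X$ is definable if for every $x\in X$ the map $g\mapsto gx$ is definable. *)

(* Defs.v *)
From HB Require Import structures.
From mathcomp Require Import all_boot all_order all_algebra.
From Stdlib Require List.
From mathcomp Require Import all_classical all_reals all_analysis.
Set Implicit Arguments.
Unset Strict Implicit.
Unset Printing Implicit Defensive.
Import Order.TTheory GRing.Theory Num.Theory.
Import numFieldNormedType.Exports.
Local Open Scope classical_set_scope.
Local Open Scope ring_scope.

Record language := Language {
  funs : Type; farity : funs -> nat;
  rels : Type; rarity : rels -> nat }.

Inductive term (L : language) (V : Type) : Type :=
| Var of V
| App (f : funs L) of ('I_(farity f) -> term L V).

(* [formula L V]: first-order L-formulas whose free variables are in V; the
   variable bound by [Ex] is [None].  An L-formula in the variables V with
   parameters from A is an element of [formula L (V + A)]. *)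
Inductive formula (L : language) (V : Type) : Type :=
| Eq of term L V & term L V
| Rel (r : rels L) of ('I_(rarity r) -> term L V)
| Not of formula L V
| And of formula L V & formula L V
| Ex of formula L (option V).

Record structure (L : language) := Structure {
  dom :> Type;
  dom_inhabited : inhabited dom;
  finterp : forall f : funs L, ('I_(farity f) -> dom) -> dom;
  rinterp : forall r : rels L, ('I_(rarity r) -> dom) -> Prop }.

Section Semantics.
Variables (L : language) (M : structure L).

Fixpoint eval (V : Type) (v : V -> M) (t : term L V) : M :=
  match t with
  | Var x => v x
  | App f ts => finterp (fun i => eval v (ts i))
  end.

Definition scons (V : Type) (m : M) (v : V -> M) (x : option V) : M :=
  if x is Some y then v y else m.

Fixpoint holds (V : Type) (phi : formula L V) (v : V -> M) : Prop :=
  match phi with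
  | Eq s t => eval v s = eval v t
  | Rel r ts => @rinterp _ M r (fun i => eval v (ts i))
  | Not psi => ~ holds psi v
  | And psi1 psi2 => holds psi1 v /\ holds psi2 v
  | Ex psi => exists m, holds psi (scons m v)
  end.

End Semantics.

Fixpoint trename L (V W : Type) (f : V -> W) (t : term L V) : term L W :=
  match t with
  | Var x => Var L (f x)
  | App g ts => App (fun i => trename f (ts i))
  end.

Fixpoint rename L (V W : Type) (f : V -> W) (phi : formula L V) : formula L W :=
  match phi with
  | Eq s t => Eq (trename f s) (trename f t)
  | Rel r ts => Rel (fun i => trename f (ts i))
  | Not psi => Not (rename f psi)
  | And psi1 psi2 => And (rename f psi1) (rename f psi2)
  | Ex psi => Ex (rename (omap f) psi)
  end.

Definition Th L (M : structure L) : set (formula L void) :=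
  [set phi | holds phi (of_void M)].

Record elem_ext L (M N : structure L) := ElemExt {
  emb :> M -> N;
  embP : forall (V : Type) (phi : formula L V) (v : V -> M),
    holds phi v <-> holds phi (emb \o v) }.

Lemma elem_id_subproof L (M : structure L) (V : Type) (phi : formula L V)
    (v : V -> M) :
  holds phi v <-> holds phi (id \o v).
Proof. by []. Qed.

Definition elem_id L (M : structure L) : elem_ext M M :=
  ElemExt (@elem_id_subproof L M).

Definition join (A B T : Type) (f : A -> T) (g : B -> T) (x : A + B) : T :=
  match x with inl a => f a | inr b => g b end.

(* p is a set of formulas in the variables V with parameters from A, where A
   is mapped to the structure by i. *)
Definition finsat L (M : structure L) (A : Type) (i : A -> M) (V : Type)
    (p : set (formula L (V + A))) : Prop :=
  forall s : set (formula L (V + A)), finite_set s -> s `<=` p ->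
    exists a : V -> M, forall phi, s phi -> holds phi (join a i).

Definition saturated L (M : structure L) (small : set (set M)) : Prop :=
  forall A : set M, small A ->
  forall n (p : set (formula L ('I_n + A))), finsat (set_val : A -> M) p ->
    exists a : 'I_n -> M, forall phi, p phi -> holds phi (join a set_val).

Definition omega1_saturated L (M : structure L) : Prop :=
  saturated [set A : set M | countable A].

Definition automorphism L (M : structure L) (s : M -> M) : Prop :=
  [/\ bijective s,
      forall (f : funs L) (u : 'I_(farity f) -> M),
        s (finterp u) = finterp (s \o u) &
      forall (r : rels L) (u : 'I_(rarity r) -> M),
        rinterp u <-> rinterp (s \o u)].

Definition strongly_homogeneous L (M : structure L) (small : set (set M)) :=
  forall A : set M, small A -> forall h : M -> M,
    (forall (V : Type) (phi : formula L V) (v : V -> M), (forall x, A (v x)) ->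
       holds phi v <-> holds phi (h \o v)) ->
    exists2 s, automorphism s & forall a, A a -> s a = h a.

(* [formula L M] has cardinality |M| + |L| + aleph_0, so this asks for
   kappa-saturation and strong kappa-homogeneity with
   kappa = (|M| + |L| + aleph_0)^+. *)
Definition monster L (M C : structure L) : Prop :=
  let small := [set A : set C | (A #<= [set: formula L M])%card] in
  saturated small /\ strongly_homogeneous small.

(* A formula X : formula L (V + M), with V the finite type of its variables,
   stands for a definable set with parameters from M; [pts e X] is X(N) for an
   elementary extension e : M -> N, and [mpts X] is X(M). *)
Definition pts L (M N : structure L) (e : elem_ext M N) (V : finType)
    (X : formula L (V + M)) : Type :=
  {a : V -> N | holds X (join a e)}.

Notation mpts X := (pts (elem_id _) X).

(* The space S_X(M) of complete types over M concentrated on X.  Consistency of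
   a set of formulas over M with the elementary diagram of M is finite
   satisfiability in M. *)
Record ctype L (M : structure L) (V : finType) (X : formula L (V + M)) :=
CType {
  ct_set :> formula L (V + M) -> Prop;
  ct_finsat : finsat id ct_set;
  ct_complete : forall phi, ct_set phi \/ ct_set (Not phi);
  ct_conc : ct_set X }.
Arguments ct_finsat {L M V X} c.

Lemma ctype_inj L (M : structure L) (V : finType) (X : formula L (V + M))
  (p q : ctype X) : (p : formula L (V + M) -> Prop) = q -> p = q.
Proof.
case: p q => [p p1 p2 p3] [q q1 q2 q3] /= pq; case: q / pq q1 q2 q3 => *.
by congr CType; exact: Prop_irrelevance.
Qed.

Section Tuples.
Variables (L : language) (M : structure L).

Lemma eval_rename (N : structure L) (V W : Type) (f : V -> W) (v : W -> N)
    (t : term L V) : eval v (trename f t) = eval (v \o f) t.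
Proof. by elim: t => //= g ts IH; congr finterp; apply/funext => i. Qed.

Lemma scons_omap (N : structure L) (V W : Type) (f : V -> W) (v : W -> N) m :
  scons m v \o omap f = scons m (v \o f).
Proof. by apply/funext => -[]. Qed.

Lemma holds_rename (N : structure L) (V W : Type) (f : V -> W) (phi : formula L V)
    (v : W -> N) : holds (rename f phi) v <-> holds phi (v \o f).
Proof.
elim: phi W f v => {V} [V s t|V r ts|V psi IH|V psi1 IH1 psi2 IH2|V psi IH] W f v /=.
- by rewrite !eval_rename.
- by under eq_fun do rewrite eval_rename.
- by rewrite IH.
- by rewrite IH1 IH2.
- by split=> -[m H]; exists m; move: H; rewrite IH scons_omap.
Qed.

Definition prodf (V W : finType) (X : formula L (V + M))
    (Y : formula L (W + M)) : formula L ((V + W) + M) :=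
  And (rename (join (inl \o inl) inr) X) (rename (join (inl \o inr) inr) Y).

Lemma prodfP (N : structure L) (e : M -> N) (V W : finType)
    (X : formula L (V + M)) (Y : formula L (W + M)) a b :
  holds (prodf X Y) (join (join a b) e) <->
  holds X (join a e) /\ holds Y (join b e).
Proof.
rewrite /= !holds_rename.
set u := (X in holds _ X /\ _); set v := (X in _ /\ holds _ X).
have -> : u = join a e by apply/funext => -[].
by have -> : v = join b e by apply/funext => -[].
Qed.

Lemma pts_inj (N : structure L) (e : elem_ext M N) (V : finType)
    (X : formula L (V + M)) (a b : pts e X) : sval a = sval b -> a = b.
Proof. by case: a b => [a Xa] [b Xb] /= ab; exact: eq_exist. Qed.

Section Pairs.
Variables (N : structure L) (e : elem_ext M N) (V W : finType).
Variables (X : formula L (V + M)) (Y : formula L (W + M)).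

Definition ppair (a : pts e X) (b : pts e Y) : pts e (prodf X Y) :=
  exist _ (join (sval a) (sval b))
    ((prodfP e X Y _ _).2 (conj (proj2_sig a) (proj2_sig b))).

Lemma join_eta (A B T : Type) (c : A + B -> T) : join (c \o inl) (c \o inr) = c.
Proof. by apply/funext => -[]. Qed.

Lemma prodf_proj (c : pts e (prodf X Y)) :
  holds X (join (sval c \o inl) e) /\ holds Y (join (sval c \o inr) e).
Proof. by apply/prodfP; rewrite join_eta; exact: proj2_sig c. Qed.

Definition pfst (c : pts e (prodf X Y)) : pts e X :=
  exist _ (sval c \o inl) (prodf_proj c).1.
Definition psnd (c : pts e (prodf X Y)) : pts e Y :=
  exist _ (sval c \o inr) (prodf_proj c).2.

Lemma pfst_ppair a b : pfst (ppair a b) = a.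
Proof. exact: pts_inj. Qed.

Lemma psnd_ppair a b : psnd (ppair a b) = b.
Proof. exact: pts_inj. Qed.

End Pairs.
End Tuples.

Section BlockEx.
Variable (L : language).

Definition bind_var (V : Type) (x y : V) : option V :=
  if pselect (y = x) then None else Some y.

Definition exvar (V : Type) (x : V) (phi : formula L V) : formula L V :=
  Ex (rename (bind_var x) phi).

Definition exvars (V : Type) (s : seq V) (phi : formula L V) := foldr (@exvar V) phi s.

Lemma holds_exvars (N : structure L) (V : Type) (s : seq V) (phi : formula L V)
    (v : V -> N) :
  holds (exvars s phi) v <->
  exists2 u : V -> N, (forall y, ~ List.In y s -> u y = v y) & holds phi u.
Proof.
elim: s v => [|x s IH] v /=.
  split=> [H|[u uv H]]; first by exists v.
  by have -> : v = u by apply/funext => y; rewrite uv.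
split=> [[m]|[u uv H]].
- rewrite holds_rename IH => -[u uv H]; exists u => // y ny.
  rewrite uv; last by move=> ys; apply: ny; right.
  rewrite /= /bind_var; case: pselect => //= yx.
  by exfalso; apply: ny; left.
- exists (u x); rewrite holds_rename IH; exists u => // y ny.
  rewrite /= /bind_var; case: pselect => [e|yx] /=; first by rewrite e.
  by apply: uv => -[/esym|].
Qed.

(* Quantify over the variables W; what remains is [formula L U] after sending
   the dummy variables W anywhere. *)
Definition exblock (U : Type) (W : finType) (d : W -> U) (phi : formula L (U + W)) :
    formula L U :=
  rename (join id d) (exvars (map inr (enum W)) phi).

Lemma holds_exblock (N : structure L) (U : Type) (W : finType) (d : W -> U)
    (phi : formula L (U + W)) (v : U -> N) :
  holds (exblock d phi) v <-> exists w : W -> N, holds phi (join v w).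
Proof.
rewrite /exblock holds_rename holds_exvars; split=> [[u uv H]|[w H]].
- exists (u \o inr).
  suff -> : join v (u \o inr) = u by [].
  apply/funext => -[x|//] /=; rewrite uv //.
  by elim: (enum W) => //= y s IH [].
- exists (join v w) => // -[//|y] ny; exfalso; apply: ny.
  have : y \in enum W by rewrite mem_enum.
  elim: (enum W) => //= z s IH; rewrite in_cons => /predU1P[->|/IH]; tauto.
Qed.

End BlockEx.

Section Types.
Variables (L : language) (M : structure L).

Definition definable_fun (V W : finType) (X : formula L (V + M))
    (Y : formula L (W + M)) (f : mpts X -> mpts Y) : Prop :=
  exists Gamma : formula L ((V + W) + M), forall (a : mpts X) (b : mpts Y),
    holds Gamma (join (join (sval a) (sval b)) id) <-> f a = b.

Section Tp.
Variables (N : structure L) (e : elem_ext M N) (V : finType).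
Variable (X : formula L (V + M)).

Lemma tp_finsat (a : pts e X) :
  finsat id [set phi : formula L (V + M) | holds phi (join (sval a) e)].
Proof.
move=> s sfin sp.
have [phi Hphi] : exists phi : formula L (V + M), forall (K : structure L) v,
    @holds L K _ phi v <-> forall psi, s psi -> holds psi v.
  have /finite_seqP[l ->] : finite_set (s : set {classic formula L (V + M)}).
    exact: sfin.
  elim: l => [|psi l [phi IH]].
    exists (Not (And X (Not X))) => K v /=; split => // _ [? nX]; exact: nX.
  exists (And psi phi) => K v /=; rewrite IH; split.
    by move=> [H1 H2] chi; rewrite /= in_cons => /predU1P[->|] //; exact: H2.
  move=> H; split; first by apply: H; rewrite /= mem_head.
  by move=> chi lchi; apply: H; rewrite /= in_cons lchi orbT.
have [m0] := dom_inhabited M.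
pose sw (x : V + M) : M + V := match x with inl v => inr v | inr m => inl m end.
pose E := exblock (fun _ : V => m0) (rename sw phi).
have swE (K : structure L) (c : V -> K) (d : M -> K) :
  join d c \o sw = join c d by apply/funext => -[].
have : holds E (id : M -> M).
  rewrite (embP e) holds_exblock; exists (sval a).
  by rewrite holds_rename swE Hphi => psi /sp.
by rewrite holds_exblock => -[c]; rewrite holds_rename swE Hphi; exists c.
Qed.

Lemma tp_complete (a : pts e X) (phi : formula L (V + M)) :
  holds phi (join (sval a) e) \/ holds (Not phi) (join (sval a) e).
Proof. exact: EM. Qed.

Definition tp (a : pts e X) : ctype X :=
  CType (@tp_finsat a) (@tp_complete a) (proj2_sig a).

End Tp.

Section Pushforward.
Variables (V W : finType) (X : formula L (V + M)) (Y : formula L (W + M)).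
Variables (f : mpts X -> mpts Y) (df : definable_fun f).

(* psi is in f_* p iff the definable set f^-1(psi) is in p. *)
Definition push_set (p : ctype X) : set (formula L (W + M)) :=
  [set psi | exists2 chi, p chi & forall a : mpts X,
     holds chi (join (sval a) id) -> holds psi (join (sval (f a)) id)].

Lemma preimage_formula (psi : formula L (W + M)) :
  exists chi : formula L (V + M), forall a : mpts X,
    holds chi (join (sval a) id) <-> holds psi (join (sval (f a)) id).
Proof.
have [Gamma HGamma] := df; have [m0] := dom_inhabited M.
pose r (x : (V + W) + M) : (V + M) + W :=
  match x with
  | inl (inl v) => inl (inl v) | inl (inr w) => inr w | inr m => inl (inr m)
  end.
pose t (x : W + M) : (V + M) + W :=
  match x with inl w => inr w | inr m => inl (inr m) end.
exists (exblock (fun _ : W => inr m0)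
  (And (rename r Gamma) (And (rename t Y) (rename t psi)))) => a.
rewrite holds_exblock.
have rE w : join (join (sval a) id) w \o r = join (join (sval a) w) id.
  by apply/funext => -[[]|].
have tE w : join (join (sval a) id) w \o t = join w id.
  by apply/funext => -[].
split=> [[w] /=|H].
- rewrite !holds_rename rE tE => -[Gw [Yw psiw]].
  by have /= -> := (HGamma a (exist _ w Yw)).1 Gw.
- exists (sval (f a)) => /=; rewrite !holds_rename rE tE.
  split; first exact/HGamma.
  by split=> //; exact: proj2_sig (f a).
Qed.

Lemma ctype_incompat (p : ctype X) (phi psi : formula L (V + M)) :
  p phi -> p psi -> exists a : mpts X,
    holds phi (join (sval a) id) /\ holds psi (join (sval a) id).
Proof.
move=> pphi ppsi; have := ct_finsat p.
move=> /(_ [set X; phi; psi]) [||a Ha].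
- by rewrite -setUA; do 2!(rewrite finite_setU; split=> //).
- by move=> _ [[->|->]|->] //; exact: ct_conc.
have Xa : holds X (join a id) by apply: Ha; left; left.
exists (exist _ a Xa); split; first by apply: Ha; left; right.
by apply: Ha; right.
Qed.

Lemma push_setP (p : ctype X) psi (chi : formula L (V + M)) :
    (forall a : mpts X,
      holds chi (join (sval a) id) <-> holds psi (join (sval (f a)) id)) ->
  push_set p psi <-> p chi.
Proof.
move=> Hchi; split=> [[th pth H]|pchi]; last by exists chi => // a /Hchi.
have [//|nchi] := ct_complete p chi.
by have [a [/H /Hchi ? ?]] := ctype_incompat pth nchi.
Qed.

Lemma push_finsat (p : ctype X) : finsat id (push_set p).
Proof.
move=> s sfin sp.
have /finite_seqP[l sl] : finite_set (s : set {classic formula L (W + M)}).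
  exact: sfin.
have [chi pchi H] : exists2 chi : formula L (V + M), p chi &
    forall a : mpts X, holds chi (join (sval a) id) ->
    forall psi, s psi -> holds psi (join (sval (f a)) id).
  have : forall psi, psi \in l -> push_set p psi.
    by move=> psi ls; apply: sp; rewrite sl.
  rewrite {}sl; elim: l {sp sfin s} => [|psi l IH] Hl.
    by exists X; [exact: ct_conc|].
  have [chi pchi H] : exists2 chi : formula L (V + M), p chi &
      forall a : mpts X, holds chi (join (sval a) id) ->
      forall psi, psi \in l -> holds psi (join (sval (f a)) id).
    by apply: IH => th lth; apply: Hl; rewrite in_cons lth orbT.
  have [th pth Hth] := Hl psi (mem_head _ _).
  exists (And th chi).
    have [//|n] := ct_complete p (And th chi).
    move: (ct_finsat p) => /(_ [set Not (And th chi); th; chi]) [||b Hb].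
    - by rewrite -setUA; do 2!(rewrite finite_setU; split=> //).
    - by move=> _ [[->|->]|->].
    have := Hb (Not (And th chi)) (or_introl (or_introl erefl)).
    by case; split; apply: Hb; [left; right|right].
  move=> a /= [a1 a2] phi; rewrite in_cons => /predU1P[->|]; first exact: Hth.
  exact: H.
have [a [_ chia]] := ctype_incompat (ct_conc p) pchi.
by exists (sval (f a)) => psi; exact: H.
Qed.

Lemma push_complete (p : ctype X) psi : push_set p psi \/ push_set p (Not psi).
Proof.
have [chi Hchi] := preimage_formula psi.
have [pchi|nchi] := ct_complete p chi; first by left; apply/(push_setP p Hchi).
by right; exists (Not chi) => // a /=; rewrite Hchi.
Qed.

Lemma push_conc (p : ctype X) : push_set p Y.
Proof. by exists X; [exact: ct_conc|move=> a _; exact: proj2_sig (f a)]. Qed.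

Definition push (p : ctype X) : ctype Y :=
  CType (@push_finsat p) (@push_complete p) (@push_conc p).

(* push computes the type of f(c), for c in any elementary extension. *)
Lemma push_tp Gamma (N : structure L) (e : elem_ext M N) (c : pts e X)
    (d : pts e Y) :
    (forall (a : mpts X) (b : mpts Y),
       holds Gamma (join (join (sval a) (sval b)) id) <-> f a = b) ->
  holds Gamma (join (join (sval c) (sval d)) e) ->
  forall psi, push (tp c) psi <-> tp d psi.
Proof.
move=> HGamma Gcd.
have key psi : push (tp c) psi -> tp d psi.
  move=> [chi /= chic H]; apply: contrapT => npsi.
  pose fX := @rename L _ _ (fun x : V + M =>
    match x with inl v => inr (inl v) | inr m => inl m end : M + (V + W)).
  pose fY := @rename L _ _ (fun x : W + M =>
    match x with inl w => inr (inr w) | inr m => inl m end : M + (V + W)).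
  pose fG := @rename L _ _ (fun x : (V + W) + M =>
    match x with inl u => inr u | inr m => inl m end : M + (V + W)).
  have [m0] := dom_inhabited M.
  pose E := exblock (fun _ : V + W => m0) (And (And (fX X) (fX chi))
    (And (fG Gamma) (And (fY Y) (Not (fY psi))))).
  have EP (K : structure L) (i : M -> K) : holds E i <->
      exists a b, [/\ holds X (join a i), holds chi (join a i),
        holds Gamma (join (join a b) i), holds Y (join b i) &
        ~ holds psi (join b i)].
    have jX w th : holds (fX th) (join i w) <-> holds th (join (w \o inl) i).
      by rewrite holds_rename; set u := _ \o _;
        have -> : u = join (w \o inl) i by apply/funext => -[].
    have jY w th : holds (fY th) (join i w) <-> holds th (join (w \o inr) i).
      by rewrite holds_rename; set u := _ \o _;
        have -> : u = join (w \o inr) i by apply/funext => -[].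
    have jG w th : holds (fG th) (join i w) <-> holds th (join w i).
      by rewrite holds_rename; set u := _ \o _;
        have -> : u = join w i by apply/funext => -[].
    rewrite holds_exblock; split=> [[w] /=|[a [b [? ? ? ? ?]]]].
      rewrite !jX jG !jY => -[[? ?] [? [? ?]]].
      by exists (w \o inl), (w \o inr); rewrite join_eta.
    by exists (join a b) => /=; rewrite !jX jG !jY.
  have : holds E e.
    by apply/EP; exists (sval c), (sval d); split=> //; [exact: proj2_sig c|exact: proj2_sig d].
  have -> : emb e = e \o id by [].
  rewrite -(embP e E id) EP => -[a [b [Xa chia Gab Yb nb]]].
  apply: nb; have := H (exist _ a Xa) chia.
  by have -> := (HGamma (exist _ a Xa) (exist _ b Yb)).1 Gab.
move=> psi; split; first exact: key.
by move=> dpsi; have [//|/key] := push_complete (tp c) psi.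
Qed.

End Pushforward.

HB.instance Definition _ (V : finType) (X : formula L (V + M)) :=
  gen_eqMixin (ctype X).
HB.instance Definition _ (V : finType) (X : formula L (V + M)) :=
  gen_choiceMixin (ctype X).

Section Topology.
Variables (V : finType) (X : formula L (V + M)).

Definition clopen_of (phi : formula L (V + M)) : set (ctype X) :=
  [set p | p phi].

Lemma clopen_cover : \bigcup_(A in range clopen_of) A = setT.
Proof.
apply/seteqP; split=> // p _; exists (clopen_of X); first by exists X.
exact: ct_conc.
Qed.

Lemma ctype_and (p : ctype X) phi psi : p (And phi psi) <-> p phi /\ p psi.
Proof.
have key th1 th2 th3 : p th1 -> p th2 -> p th3 ->
    exists a : V -> M, [/\ holds th1 (join a id), holds th2 (join a id) &
      holds th3 (join a id)].
  move=> p1 p2 p3; have := ct_finsat p.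
  move=> /(_ [set th1; th2; th3]) [||a Ha].
  - by rewrite -setUA; do 2!(rewrite finite_setU; split=> //).
  - by move=> _ [[->|->]|->].
  - by exists a; split; apply: Ha; [left; left|left; right|right].
split=> [H|[H1 H2]]; last first.
  by have [//|n] := ct_complete p (And phi psi);
    have [a /= [? ? []]] := key _ _ _ H1 H2 n.
by split; [have [//|n] := ct_complete p phi|have [//|n] := ct_complete p psi];
  have [a /= [[? ?] ?]] := key _ _ _ H n n.
Qed.

Lemma clopen_join (A B : set (ctype X)) (p : ctype X) :
  range clopen_of A -> range clopen_of B -> A p -> B p ->
  exists C, [/\ range clopen_of C, C p & C `<=` A `&` B].
Proof.
move=> [phi _ <-] [psi _ <-] pphi ppsi; exists (clopen_of (And phi psi)).
split; [by exists (And phi psi)|exact/ctype_and|by move=> q /ctype_and].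
Qed.

HB.instance Definition _ := @isBaseTopological.Build (ctype X)
  (set (ctype X)) (range clopen_of) id clopen_cover clopen_join.

Lemma clopen_of_open phi : open (clopen_of phi).
Proof.
exists [set clopen_of phi]; first by move=> _ ->; exists phi.
by rewrite bigcup_set1.
Qed.

End Topology.

Lemma push_continuous (V W : finType) (X : formula L (V + M))
    (Y : formula L (W + M)) (f : mpts X -> mpts Y) (df : definable_fun f) :
  continuous (push df).
Proof.
apply/continuousP => A [D DS <-]; rewrite preimage_bigcup.
apply: bigcup_open => B /DS [psi _ <-].
have [chi Hchi] := preimage_formula df psi.
suff -> : push df @^-1` clopen_of psi = clopen_of chi by exact: clopen_of_open.
by apply/seteqP; split=> p /(push_setP p Hchi).
Qed.

End Types.

Record defgroup L (M : structure L) := DefGroup {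
  gdim : nat;
  gdom : formula L ('I_gdim + M);
  gone : mpts gdom;
  ginv : mpts gdom -> mpts gdom;
  gmul : mpts gdom -> mpts gdom -> mpts gdom;
  gmulA : associative gmul;
  gmul1g : left_id gone gmul;
  gmulg1 : right_id gone gmul;
  gmulVg : left_inverse gone ginv gmul;
  gmulgV : right_inverse gone ginv gmul;
  gmul_definable :
    definable_fun (fun c : mpts (prodf gdom gdom) => gmul (pfst c) (psnd c)) }.

Section DefGroup.
Variables (L : language) (M : structure L) (G : defgroup M).

Definition gpts : Type := mpts (gdom G).

HB.instance Definition _ := gen_eqMixin gpts.
HB.instance Definition _ := gen_choiceMixin gpts.
HB.instance Definition _ := isGroup.Build gpts
  (@gmulA _ _ G) (@gmul1g _ _ G) (@gmulg1 _ _ G) (@gmulVg _ _ G)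
  (@gmulgV _ _ G).

Definition gtypes : topologicalType := ctype (gdom G).

Lemma ltrans_definable (g : gpts) : definable_fun (gmul g).
Proof.
have [Gamma HGamma] := gmul_definable G.
exists (rename (fun x : (('I_(gdim G) + 'I_(gdim G)) + 'I_(gdim G)) + M =>
  match x with
  | inl (inl (inl i)) => inr (sval g i)
  | inl (inl (inr j)) => inl (inl j)
  | inl (inr k) => inl (inr k)
  | inr m => inr m
  end) Gamma) => a b.
have := HGamma (ppair g a) b; rewrite pfst_ppair psnd_ppair => <-.
rewrite holds_rename; set u := _ \o _.
by have -> : u = join (join (sval (ppair g a)) (sval b)) id
  by apply/funext => -[[[]|]|].
Qed.

(* the left action of G(M) on S_G(M): psi(x) is in g . p iff psi(g x) is in p *)
Definition tact (g : gpts) : gtypes -> gtypes := push (ltrans_definable g).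

(* the definable map (x, y) |-> y x *)
Definition opmul (c : mpts (prodf (gdom G) (gdom G))) : mpts (gdom G) :=
  gmul (psnd c) (pfst c).

Lemma opmul_graph Gamma :
    (forall (c : mpts (prodf (gdom G) (gdom G))) (b : mpts (gdom G)),
       holds Gamma (join (join (sval c) (sval b)) id) <->
       gmul (pfst c) (psnd c) = b) ->
  forall (c : mpts (prodf (gdom G) (gdom G))) (b : mpts (gdom G)),
    holds (rename (join (inl \o join (inl \o join inr inl) inr) inr) Gamma)
      (join (join (sval c) (sval b)) id) <-> opmul c = b.
Proof.
move=> HGamma c b; have := HGamma (ppair (psnd c) (pfst c)) b.
rewrite pfst_ppair psnd_ppair => <-; rewrite holds_rename; set u := _ \o _.
by have -> : u = join (join (sval (ppair (psnd c) (pfst c))) (sval b)) id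
  by apply/funext => -[[[]|]|].
Qed.

Lemma opmul_definable : definable_fun opmul.
Proof.
by have [Gamma /opmul_graph HGamma] := gmul_definable G; eexists; exact: HGamma.
Qed.

(* the CL-formula F(yx) on G x G: its value at the type of (x, y) is the value
   of F at the type of yx, see [Fyx_tp] *)
Definition Fyx (R : Type) (F : gtypes -> R) : ctype (prodf (gdom G) (gdom G)) -> R :=
  F \o push opmul_definable.

(* In an elementary extension N, the product of b and a is the point c with
   N |= Gamma(b, a, c), where Gamma defines the group law. *)
Lemma Fyx_tp (R : Type) (F : gtypes -> R) Gamma (N : structure L)
    (e : elem_ext M N) (a b c : pts e (gdom G)) :
    (forall (c : mpts (prodf (gdom G) (gdom G))) (b : mpts (gdom G)),
       holds Gamma (join (join (sval c) (sval b)) id) <->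
       gmul (pfst c) (psnd c) = b) ->
  holds Gamma (join (join (sval (ppair b a)) (sval c)) e) ->
  Fyx F (tp (ppair a b)) = F (tp c).
Proof.
move=> HGamma Gbac; congr F; apply: ctype_inj.
apply/funext => psi; apply/propext.
apply: (push_tp opmul_definable (opmul_graph HGamma)).
rewrite holds_rename; set u := _ \o _.
by have -> : u = join (join (sval (ppair b a)) (sval c)) e
  by apply/funext => -[[[]|]|].
Qed.

Lemma Fyx_continuous (R : topologicalType) (F : gtypes -> R) :
  continuous F -> continuous (Fyx F).
Proof.
by move=> cF p; apply: continuous_comp; [exact: push_continuous|exact: cF].
Qed.

Definition definable_set (Z : set gpts) : Prop :=
  exists psi : formula L ('I_(gdim G) + M),
    Z = [set g | holds psi (join (sval g) id)].

Definition definable_map (C : topologicalType) (f : gpts -> C) : Prop :=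
  forall C1 C2 : set C, closed C1 -> closed C2 -> C1 `&` C2 = set0 ->
    exists Z, [/\ definable_set Z, f @^-1` C1 `<=` Z & f @^-1` C2 `<=` ~` Z].

Definition definable_action (X : topologicalType) (act : gpts -> X -> X) :=
  forall x, definable_map (act ^~ x).

End DefGroup.

(* Stability in M is [stable_in (elem_id M)]; stability for T is [stable_in e]
   with e : M -> C an elementary embedding in a monster model. *)
Definition stable_in (R : realType) L (M N : structure L) (e : elem_ext M N)
    (V W : finType) (X : formula L (V + M)) (Y : formula L (W + M))
    (phi : ctype (prodf X Y) -> R) : Prop :=
  forall eps : R, 0 < eps ->
  ~ exists (a : nat -> pts e X) (b : nat -> pts e Y),
      forall i j, (i < j)%N ->
        eps <= `|phi (tp (ppair (a i) (b j))) - phi (tp (ppair (a j) (b i)))|.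

(* G is treated as a discrete group; [act g] is a homeomorphism since its
   inverse [act g^-1] is continuous as well. *)
Record is_flow (G : groupType) (X : topologicalType) (act : G -> X -> X) :
    Prop := IsFlow {
  flow_compact : compact [set: X];
  flow_hausdorff : hausdorff_space X;
  flow_act1 : forall x, act 1%g x = x;
  flow_actM : forall g h x, act (g * h)%g x = act g (act h x);
  flow_continuous : forall g, continuous (act g) }.

Section WAP.
Variables (R : realType) (G : groupType) (X : topologicalType).
Variable act : G -> X -> X.

Definition translates (f : X -> R) : set {ptws X -> R} :=
  [set f \o act g | g in [set: G]].

Definition wap_fun (f : X -> R) : Prop :=
  forall h : X -> R, closure (translates f) h -> continuous h.

Definition wap_flow : Prop := forall f : X -> R, continuous f -> wap_fun f.

End WAP.

(* Main.v *)
Require Import Defs.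
From mathcomp Require Import all_boot all_order all_algebra.
From mathcomp Require Import all_classical all_reals all_analysis.
From mathcomp Require Import lra.
Set Implicit Arguments.
Unset Strict Implicit.
Unset Printing Implicit Defensive.
Import Order.TTheory GRing.Theory Num.Theory.
Import numFieldNormedType.Exports.
Local Open Scope classical_set_scope.
Local Open Scope ring_scope.

(* For f on X continuous and x = pi p, the formula F(yx) of F = f o pi takes at
   (a, b) in G(M) the value f(b y_a), where y_a = pi(tp a) ranges over a dense
   subset of X.  Hence stability in M is Grothendieck's double limit condition
   for f, which is equivalent to weak almost periodicity: limits of translates
   along an ultrafilter are continuous, so iterated limits commute; conversely
   a discontinuous limit of translates yields, point by point, a sequence
   violating the double limit condition.  If M is omega_1-saturated, a definable
   action makes iterated limits commute because the limit behaviour of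
   countably many b_j is realized by a single b in G(M), and a violation of
   stability in an elementary extension can be copied into M, since it is
   witnessed by countably many formulas. *)

(** * Limits along ultrafilters *)

Lemma fmap_ultra (I T : Type) (u : I -> T) (U : set_system I) :
  UltraFilter U -> UltraFilter (u @ U).
Proof.
move=> UU; split; first exact: fmap_proper_filter.
move=> G PG sUG; rewrite predeqE => A; split; last exact: sUG.
move=> GA; have [//|nA] := in_ultra_setVsetC (u @^-1` A) UU.
have /filter_ex[t []//] : G (A `&` ~` A).
by apply: filterI => //; apply: sUG.
Qed.

Lemma compact_ultralim (X : topologicalType) (I : Type) (u : I -> X)
    (U : set_system I) :
  compact [set: X] -> UltraFilter U -> exists x : X, u @ U --> x.
Proof.
rewrite compact_ultra => cX UU.
have [|x [_ ux]] := cX _ (fmap_ultra u UU); first exact: filterT.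
by exists x.
Qed.

(** * Weak almost periodicity and the double limit condition *)

Section WeaklyAlmostPeriodic.
Variables (R : realType) (G : groupType) (X : topologicalType).
Variables (act : G -> X -> X) (f : X -> R).
Hypotheses (act_cont : forall g, continuous (act g)) (f_cont : continuous f).
Hypothesis X_compact : compact [set: X].

Lemma wap_ultralim_continuous (I : Type) (b : I -> G) (U : set_system I)
    (h : X -> R) : UltraFilter U -> wap_fun act f ->
  (forall x, f (act (b i) x) @[i --> U] --> h x) -> continuous h.
Proof.
move=> UU wf fh; apply: wf; rewrite closureEcvg.
exists ((fun i => f \o act (b i)) @ U); first exact: fmap_proper_filter.
split; first by apply/pointwise_cvgP.
by move=> A fA; apply: (@filterE _ U) => i; apply: fA; exists (b i).
Qed.

Lemma ultralim_act (I : Type) (b : I -> G) (U : set_system I) :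
  UltraFilter U -> exists h : X -> R,
    forall x, f (act (b i) x) @[i --> U] --> h x.
Proof.
move=> UU.
suff /choice[h hP] : forall x, exists l : R, f (act (b i) x) @[i --> U] --> l.
  by exists h.
move=> x; have [z bz] := compact_ultralim (fun i => act (b i) x) X_compact UU.
by exists (f z); apply: continuous_cvg => //; exact: f_cont.
Qed.

(** For an ultrafilter [U] refining [\oo], both iterated limits of [f (act (b j) (x i))] equal
    [h z]: taking [j] first uses continuity of the limit [h], taking [i] first only that of
    [f \o act (b j)]. *)
Lemma wap_double_limit (eps : R) : 0 < eps -> wap_fun act f ->
  ~ exists (x : nat -> X) (b : nat -> G), forall i j, (i < j)%N ->
      eps <= `|f (act (b j) (x i)) - f (act (b i) (x j))|.
Proof.
move=> e0 wf [x [b xb]].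
have [U [UU ooU]] := @ultraFilterLemma _ (\oo : set_system nat) _.
have [h bh] := ultralim_act b UU.
have ch := wap_ultralim_continuous UU wf bh.
have [z xz] := compact_ultralim x X_compact UU.
have e4 : 0 < eps / 4 by lra.
have hxz : h (x i) @[i --> U] --> h z.
  by apply: continuous_cvg => //; exact: ch.
have /filter_ex[i [/= hi bi]] : U [set i | `|h z - h (x i)| < eps / 4 /\
    `|h z - f (act (b i) z)| < eps / 4].
  by apply: filterI; [apply: cvgr_dist_lt hxz _ e4|apply: cvgr_dist_lt (bh z) _ e4].
have bxz : f (act (b i) (x j)) @[j --> U] --> f (act (b i) z).
  apply: (@continuous_cvg _ _ _ _ _ x (f \o act (b i))) => //.
  by apply: continuous_comp; [exact: act_cont|exact: f_cont].
have /filter_ex[j [/= ij [bji bij]]] : U [set j | (i < j)%N /\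
    (`|h (x i) - f (act (b j) (x i))| < eps / 4 /\
    `|f (act (b i) z) - f (act (b i) (x j))| < eps / 4)].
  apply: filterI; first by apply: ooU; exact: nbhs_infty_gt.
  by apply: filterI; [apply: cvgr_dist_lt (bh _) _ e4|apply: cvgr_dist_lt bxz _ e4].
have := xb i j ij; apply/negP; rewrite -ltNge ltr_distl.
move: hi bi bji bij; rewrite !ltr_distl.
move=> /andP[? ?] /andP[? ?] /andP[? ?] /andP[? ?]; apply/andP; split; lra.
Qed.

Lemma closure_translates_approx (h : X -> R) (s : seq X) (d : R) : 0 < d ->
  closure (translates act f) h ->
  exists g, forall x, x \in s -> `|f (act g x) - h x| < d.
Proof.
move=> d0.
rewrite closureEcvg => -[F PF [Fh tF]].
have {}Fh t : k t @[k --> F] --> h t.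
  by have /pointwise_cvgP := Fh; exact.
have Fs : F [set k | forall x, x \in s -> `|h x - k x| < d].
  elim: s => [|y s IH]; first by apply: filterE.
  have Fy : F [set k | `|h y - k y| < d] by exact: cvgr_dist_lt (Fh y) _ d0.
  apply: filterS2 IH Fy => k ks ky x.
  by rewrite in_cons => /predU1P[->//|/ks].
have Ft : F (translates act f) by exact: tF.
have /(@filter_ex _ F PF)[k [ks [g _ gk]]] := @filterI _ F PF _ _ Fs Ft.
by exists g => x /ks; rewrite -gk distrC.
Qed.

(** Used contrapositively: a discontinuity of [h] is already witnessed by points of [D]. For [z]
    near [x], some [w] in [D] is close enough to both to compare [h z] with [h x]. *)
Lemma discontinuity_on_dense (h : X -> R) (D : set X) :
    (forall (x : X) A, nbhs x A -> A `&` D !=set0) ->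
    (forall (x : X) (eps : R), 0 < eps ->
      exists2 A, nbhs x A & forall z, A z -> D z -> `|h z - h x| < eps) ->
  continuous h.
Proof.
move=> dD hD x; apply/cvgrPdist_lt => eps e0.
have e2 : 0 < eps / 2 by lra.
have [A nA Ax] := hD x _ e2; have := nA; rewrite nbhsE => -[B [oB Bx] BA].
have nB : nbhs x B by exact: open_nbhs_nbhs.
apply: filterS nB => z Bz.
have nBz : nbhs z B by exact: open_nbhs_nbhs.
have [C nC Cz] := hD z _ e2.
have [w [[Bw Cw] Dw]] := dD z _ (filterI nBz nC).
have := Ax w (BA _ Bw) Dw; have := Cz w Cw Dw.
rewrite !ltr_distl => /andP[? ?] /andP[? ?]; apply/andP; split; lra.
Qed.

(** Let [h] be discontinuous at [x]. Group elements approximating [h] at [x] and at all earlier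
    points alternate with points of [D] that the elements chosen so far cannot tell from [x], but
    [h] can. For [i < j] the two values are then near [h (x i)] and [h x]. *)
Lemma double_limit_wap (D : set X) :
    (forall (x : X) A, nbhs x A -> A `&` D !=set0) ->
    (forall eps : R, 0 < eps -> ~ exists (x : nat -> X) (b : nat -> G),
      (forall i, D (x i)) /\ forall i j, (i < j)%N ->
      eps <= `|f (act (b j) (x i)) - f (act (b i) (x j))|) ->
  wap_fun act f.
Proof.
move=> dD nseq h clh; apply: (discontinuity_on_dense dD) => x eps e0.
apply: contrapT => nA.
have {nA} far A : nbhs x A -> exists z, [/\ A z, D z & eps <= `|h z - h x|].
  move=> nxA; apply: contrapT => nz; apply: nA; exists A => // z Az Dz.
  by rewrite ltNge; apply/negP => hz; apply: nz; exists z.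
(* Three approximations by [d] cost [eps / 2], leaving a gap of [eps / 2]. *)
pose d := eps / 6; have d0 : 0 < d by rewrite /d; lra.
(* [P s p]: the pair [p] may follow the pairs listed in [s]. Choosing [p] for every list turns the
   recursion into an iteration of one function [F]. *)
pose P (s : seq (G * X)) (p : G * X) :=
  [/\ `|f (act p.1 x) - h x| < d,
      forall q, q \in s -> `|f (act p.1 q.2) - h q.2| < d,
      D p.2, eps <= `|h p.2 - h x| &
      forall q, q \in p :: s -> `|f (act q.1 x) - f (act q.1 p.2)| < d].
have /choice[F PF] : forall s, exists p, P s p.
  move=> s.
  have [g gP] := closure_translates_approx (x :: [seq q.2 | q <- s]) d0 clh.
  have : nbhs x [set z | forall g', g' \in g :: [seq q.1 | q <- s] ->
      `|f (act g' x) - f (act g' z)| < d].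
    elim: (_ :: _) => [|g' l IH]; first by apply: filterE.
    have cg : f (act g' z) @[z --> x] --> f (act g' x).
      by apply: continuous_cvg; [exact: f_cont|exact: act_cont].
    have ng : nbhs x [set z | `|f (act g' x) - f (act g' z)| < d].
      exact: cvgr_dist_lt cg _ d0.
    apply: filterS2 IH ng => z zl zg k.
    by rewrite in_cons => /predU1P[->|/zl].
  move=> /far[z [zg Dz hz]]; exists (g, z); split => //=.
  - by apply: gP; rewrite mem_head.
  - by move=> q qs; apply: gP; rewrite in_cons map_f ?orbT.
  - move=> q; rewrite in_cons => /predU1P[->|qs]; apply: zg => /=.
      by rewrite mem_head.
    by rewrite in_cons map_f ?orbT.
pose hist := fix hist n := if n is m.+1 then F (hist m) :: hist m else [::].
pose w n := F (hist n).
have wh i j : (i < j)%N -> w i \in hist j.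
  elim: j => // j IH; rewrite ltnS leq_eqVlt => /predU1P[->|/IH wi] /=.
    by rewrite mem_head.
  by rewrite in_cons wi orbT.
apply: (nseq (eps / 2)); first by lra.
exists (fun n => (w n).2), (fun n => (w n).1); split.
  by move=> i; have [] := PF (hist i).
move=> i j ij; rewrite leNgt; apply/negP.
have [hi _ _ ei _] := PF (hist i); have [_ hj _ _ fj] := PF (hist j).
have := hj _ (wh _ _ ij); have : `|f (act (w i).1 x) - f (act (w i).1 (w j).2)| < d.
  by apply: fj; rewrite in_cons wh ?orbT.
rewrite -/(w j) => w1 w2 w3; move: ei; apply/negP; rewrite -ltNge -/(w i).
move: w1 w2 w3 hi; rewrite -/(w i) !ltr_distl /d.
move=> /andP[? ?] /andP[? ?] /andP[? ?] /andP[? ?]; apply/andP; split; lra.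
Qed.

End WeaklyAlmostPeriodic.

(** * Topology of the type spaces *)

Section TypeSpace.
Variables (L : language) (M : structure L).

Section OneSort.
Variables (V : finType) (X : formula L (V + M)).

Lemma nbhs_clopen (p : ctype X) (A : set (ctype X)) : nbhs p A ->
  exists2 phi, p phi & clopen_of phi `<=` A.
Proof.
rewrite nbhsE => -[B [[D DS DB] Bp] BA].
move: Bp; rewrite -DB => -[E DE Ep]; have [phi _ phiE] := DS _ DE.
exists phi; first by move: Ep; rewrite -phiE.
by move=> q qphi; apply: BA; rewrite -DB; exists E => //; rewrite -phiE.
Qed.

Lemma clopen_of_nbhs (p : ctype X) phi : p phi -> nbhs p (clopen_of phi).
Proof. by move=> pphi; apply: open_nbhs_nbhs; split=> //; exact: clopen_of_open. Qed.

Lemma ctype_not (p : ctype X) phi : p (Not phi) <-> ~ p phi.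
Proof.
split=> [pn pp|]; last by have [] := ct_complete p phi.
by have [a [? []]] := ctype_incompat pp pn.
Qed.

(** An ultrafilter on types converges to the set of formulas whose clopen sets it contains; any
    finite part of that set lies in a single type, hence is satisfied in [M]. *)
Lemma compact_ctype : compact [set: ctype X].
Proof.
rewrite compact_ultra => U UU _.
pose p phi := U (clopen_of phi).
have p_finsat : finsat id p.
  move=> s sfin sp.
  have /finite_seqP[l sl] : finite_set (s : set {classic formula L (V + M)}).
    exact: sfin.
  suff /filter_ex[q qs] : U [set q : ctype X | forall phi, s phi -> q phi].
    by have [a Ha] := ct_finsat q _ sfin qs; exists a.
  have lp (phi : {classic formula L (V + M)}) : phi \in l -> U (clopen_of phi).
    by move=> lphi; apply: sp; rewrite sl.
  rewrite sl; elim: l {sl} lp => [|phi l IH] lp; first by apply: filterE.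
  have Ul : U [set q : ctype X | forall psi, psi \in l -> q psi].
    by apply: IH => psi lpsi; apply: lp; rewrite in_cons lpsi orbT.
  apply: filterS2 (lp phi (mem_head _ _)) Ul => q qphi ql psi /=.
  by rewrite in_cons => /predU1P[->//|/ql].
have p_complete phi : p phi \/ p (Not phi).
  have [|Un] := in_ultra_setVsetC (@clopen_of _ _ _ X phi) UU; first by left.
  by right; apply: filterS Un => q /ctype_not.
have p_conc : p X by apply: filterE => q; exact: ct_conc.
exists (CType p_finsat p_complete p_conc); split=> // A /nbhs_clopen[phi pphi phiA].
exact: filterS phiA pphi.
Qed.

Lemma ctype_realized (p : ctype X) phi : p phi ->
  exists a : mpts X, holds phi (join (sval a) id).
Proof. by move=> pphi; have [a [? _]] := ctype_incompat pphi pphi; exists a. Qed.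

Lemma tp_dense (p : ctype X) A : nbhs p A ->
  exists a : mpts X, A (tp a).
Proof.
move=> /nbhs_clopen[phi /ctype_realized[a aphi] phiA]; exists a.
exact: phiA.
Qed.

End OneSort.

Lemma push_tp_val (V W : finType) (X : formula L (V + M))
    (Y : formula L (W + M)) (f : mpts X -> mpts Y) (df : definable_fun f) a :
  push df (tp a) = tp (f a).
Proof.
apply: ctype_inj; apply/funext => psi; apply/propext.
have [chi Hchi] := preimage_formula df psi.
by rewrite /= (push_setP _ Hchi); exact: Hchi.
Qed.

End TypeSpace.

(** * Translations on the types of the group *)

Section GroupTypes.
Variables (L : language) (M : structure L) (G : defgroup M).

(** Makes right translation by [a] act on types, so that the type of [b a] becomes a continuous
    function of the type of [b]. *)
Lemma rtrans_definable (a : gpts G) : definable_fun (fun g => @gmul _ _ G g a).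
Proof.
have [Gamma HGamma] := gmul_definable G.
exists (rename (fun x : (('I_(gdim G) + 'I_(gdim G)) + 'I_(gdim G)) + M =>
  match x with
  | inl (inl (inl i)) => inl (inl i)
  | inl (inl (inr j)) => inr (sval a j)
  | inl (inr k) => inl (inr k)
  | inr m => inr m
  end) Gamma) => g b.
have := HGamma (ppair g a) b; rewrite pfst_ppair psnd_ppair => <-.
rewrite holds_rename; set u := _ \o _.
by have -> : u = join (join (sval (ppair g a)) (sval b)) id
  by apply/funext => -[[[]|]|].
Qed.

Lemma tact_tp (g a : gpts G) : tact g (tp a) = tp (gmul g a).
Proof. exact: push_tp_val. Qed.

Lemma Fyx_tp_val (T : Type) (F : gtypes G -> T) (a b : mpts (gdom G)) :
  Fyx F (tp (ppair a b)) = F (tp (gmul b a)).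
Proof.
by rewrite /Fyx /= (push_tp_val (opmul_definable G)) /opmul pfst_ppair psnd_ppair.
Qed.

End GroupTypes.

(** * Finite supports and conjunctions of formulas *)

Section Support.
Variable L : language.

Definition depends_on (V : Type) (phi : formula L V) (s : set V) : Prop :=
  forall (K : structure L) (v w : V -> K), (forall x, s x -> v x = w x) ->
    holds phi v <-> holds phi w.

Lemma term_support (V : Type) (t : term L V) : exists2 s : set V, finite_set s &
  forall (K : structure L) (v w : V -> K), (forall x, s x -> v x = w x) ->
    Defs.eval v t = Defs.eval w t.
Proof.
elim: t => [x|f ts IH].
  by exists [set x] => // K v w; exact.
have /choice[s sP] : forall i, exists s : set V, finite_set s /\
    forall (K : structure L) (v w : V -> K), (forall x, s x -> v x = w x) ->
      Defs.eval v (ts i) = Defs.eval w (ts i).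
  by move=> i; have [s ? ?] := IH i; exists s.
exists (\bigcup_(i in [set: 'I_(farity f)]) s i).
  by apply: bigcup_finite; [exact: finite_finset|move=> i _; have [] := sP i].
move=> K v w vw /=; congr finterp; apply/funext => i; apply: (sP i).2 => x si.
by apply: vw; exists i.
Qed.

(** Countably many formulas over [M] thus involve only countably many elements of [M], as an appeal
    to omega_1-saturation requires. *)
Lemma formula_support (V : Type) (phi : formula L V) :
  exists2 s, finite_set s & depends_on phi s.
Proof.
elim: phi => {V} [V t u|V r ts|V psi [s sf sP]|V psi [s sf sP] chi [s' s'f s'P]|
    V psi [s sf sP]].
- have [s sf sP] := term_support t; have [s' s'f s'P] := term_support u.
  exists (s `|` s'); first by rewrite finite_setU.
  move=> K v w vw /=; rewrite (sP K v w) ?(s'P K v w) // => x ?; apply: vw.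
    by right.
  by left.
- have /choice[s sP] : forall i, exists s : set V, finite_set s /\
      forall (K : structure L) (v w : V -> K), (forall x, s x -> v x = w x) ->
        Defs.eval v (ts i) = Defs.eval w (ts i).
    by move=> i; have [s ? ?] := term_support (ts i); exists s.
  exists (\bigcup_(i in [set: 'I_(rarity r)]) s i).
    by apply: bigcup_finite; [exact: finite_finset|move=> i _; have [] := sP i].
  move=> K v w vw /=.
  suff -> : (fun i => Defs.eval v (ts i)) = (fun i => Defs.eval w (ts i)) by [].
  by apply/funext => i; apply: (sP i).2 => x si; apply: vw; exists i.
- by exists s => // K v w vw /=; rewrite (sP K v w).
- exists (s `|` s'); first by rewrite finite_setU.
  move=> K v w vw /=; rewrite (sP K v w) ?(s'P K v w) // => x ?; apply: vw.
    by right.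
  by left.
- exists (@Some V @^-1` s); first by apply: finite_preimage => // x y _ _ [].
  move=> K v w vw /=.
  suff E m : holds psi (scons m v) <-> holds psi (scons m w).
    by split=> -[m /E]; exists m.
  by apply: sP => -[x sx|//]; exact: vw.
Qed.

Lemma finite_conj (V : Type) (s : set (formula L V)) : finite_set s ->
  exists phi : formula L V, forall (K : structure L) (v : V -> K),
    holds phi v <-> forall psi, s psi -> holds psi v.
Proof.
move=> sfin.
have /finite_seqP[l ->] : finite_set (s : set {classic formula L V}) by [].
elim: l => [|psi l [phi IH]].
  exists (Ex (Eq (Var L None) (Var L None))) => K v /=; split=> // _.
  by have [m] := dom_inhabited K; exists m.
exists (And psi phi) => K v /=; rewrite IH; split.
  by move=> [H1 H2] chi; rewrite /= in_cons => /predU1P[->|] //; exact: H2.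
move=> H; split; first by apply: H; rewrite /= mem_head.
by move=> chi lchi; apply: H; rewrite /= in_cons lchi orbT.
Qed.

End Support.

Lemma finite_leq_bound (T : Type) (s : set T) (n : T -> nat) : finite_set s ->
  exists k, forall x, s x -> (n x <= k)%N.
Proof.
move=> sfin; have /finite_seqP[l ->] : finite_set (s : set {classic T}) by [].
elim: l => [|x l [k IH]]; first by exists 0%N.
exists (maxn (n x) k) => y; rewrite /= in_cons => /predU1P[->|/IH yk].
  exact: leq_maxl.
by rewrite (leq_trans yk)// leq_maxr.
Qed.

Lemma countable_setU1 (T : Type) (D : set T) (x : T) :
  countable D -> countable (D `|` [set x]).
Proof.
move=> cD; suff -> : D `|` [set x] =
    \bigcup_(b in [set: bool]) (if b then D else [set x]).
  by apply: bigcup_countable => // -[].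
by apply/seteqP; split=> [y [Dy|->]|y [[] _]];
  [exists true|exists false|left|right].
Qed.

(** * Consequences of omega_1-saturation *)

Section Saturation.
Variables (L : language) (M : structure L).
Hypothesis M_sat : omega1_saturated M.

Lemma realize_sequence n (psi : nat -> formula L ('I_n + M)) :
  (forall k, exists a : 'I_n -> M, forall i, (i <= k)%N ->
    holds (psi i) (join a id)) ->
  exists a : 'I_n -> M, forall i, holds (psi i) (join a id).
Proof.
move=> psi_fin; have [m0] := dom_inhabited M.
have /choice[s sP] : forall i, exists s : set ('I_n + M), finite_set s /\
    depends_on (psi i) s.
  by move=> i; have [s ? ?] := formula_support (psi i); exists s.
pose A : set M := (\bigcup_(i in [set: nat]) (inr @^-1` s i)) `|` [set m0].
have cA : countable A.
  apply: countable_setU1; apply: bigcup_countable => // i _.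
  apply: finite_set_countable; apply: finite_preimage; last exact: (sP i).1.
  by move=> x y _ _ [].
have Am0 : A m0 by right.
(* [r] retracts [M] onto [A]; its default [m0] outside [A] is harmless, since no [psi i] depends on
   such elements. *)
have /choice[r rP] : forall m, exists a : A, A m -> set_val a = m.
  move=> m; have [Am|nAm] := pselect (A m); last by exists (exist _ m0 (mem_set Am0)).
  by exists (exist _ m (mem_set Am)).
pose r' (x : 'I_n + M) : 'I_n + A :=
  match x with inl i => inl i | inr m => inr (r m) end.
have r'P i a : holds (rename r' (psi i)) (join a set_val) <->
    holds (psi i) (join a id).
  rewrite holds_rename; apply: (sP i).2 => -[//|m] sm /=.
  by apply: rP; left; exists i.
have [|a aP] := M_sat cA (p := range (fun i => rename r' (psi i))).
  move=> t tfin tp; have /choice[j jP] : forall phi, exists i, t phi ->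
      rename r' (psi i) = phi.
    move=> phi; have [/tp[i _ <-]|] := pselect (t phi); first by exists i.
    by exists 0%N.
  have [k jk] := finite_leq_bound j tfin; have [a ak] := psi_fin k.
  by exists a => phi tphi; rewrite -(jP _ tphi); apply/r'P/ak/jk.
by exists a => i; apply/r'P/aP; exists i.
Qed.

(** A partial elementary map from [M] to [N], encoded by its graph; that the graph is functional
    follows from the formula [Eq]. *)
Definition elem_rel (N : structure L) (D : set (M * N)) : Prop :=
  forall (V : Type) (phi : formula L V) (v : V -> M * N), (forall x, D (v x)) ->
    holds phi (fst \o v) <-> holds phi (snd \o v).

Lemma elem_rel_functional (N : structure L) (D : set (M * N)) m n n' :
  elem_rel D -> D (m, n) -> D (m, n') -> n = n'.
Proof.
move=> De Dn Dn'; pose v (b : bool) := if b then (m, n) else (m, n').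
by apply: (De bool (Eq (Var L true) (Var L false)) v _).1 => // -[].
Qed.

(** The forth step of back-and-forth: the type of [c] over the range of [D], carried back to the
    domain of [D], is finitely satisfiable because existential formulas transfer along [D], so [M]
    realizes it. *)
Lemma elem_rel_extend (N : structure L) (D : set (M * N)) (c : N) :
  countable D -> elem_rel D -> exists m, elem_rel (D `|` [set (m, c)]).
Proof.
move=> cD De; pose A : set M := fst @` D.
have cA : countable A by exact: sub_countable (card_image_le fst D) cD.
have /choice[sg sgP] : forall a : A, exists n, D (set_val a, n).
  by move=> a; have [[m n] Dmn mE] := set_valP a; exists n; have <- : m = set_val a by [].
pose p := [set phi : formula L ('I_1 + A) | holds phi (join (fun=> c) sg)].
have [|a aP] := M_sat cA (p := p).
  move=> s sfin sp; have [phi phiP] := finite_conj sfin.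
  pose q (x : 'I_1 + A) : option A := match x with inl _ => None | inr a => Some a end.
  have qE (K : structure L) (k : K) (v : A -> K) :
    scons k v \o q = join (fun=> k) v by apply/funext => -[].
  have : holds (Ex (rename q phi)) (snd \o (fun a : A => (set_val a : M, sg a))).
    by exists c; rewrite holds_rename qE phiP => psi /sp.
  rewrite -De // => -[m].
  rewrite -[X in X -> _]/(holds (rename q phi) (scons m (set_val : A -> M))).
  by rewrite holds_rename qE phiP => mP; exists (fun=> m).
exists (a ord0) => V phi v vD.
have /choice[r rP] : forall x, exists y : 'I_1 + A,
    join a set_val y = (v x).1 /\ join (fun=> c) sg y = (v x).2.
  move=> x; have := vD x; case: (v x) => m n [Dmn|/= [-> ->]].
    have Am : A m by exists (m, n).
    exists (inr (exist _ m (mem_set Am))); split=> //=.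
    exact: (elem_rel_functional De (sgP (exist _ m (mem_set Am))) Dmn).
  by exists (inl ord0).
have -> : fst \o v = join a set_val \o r by apply/funext => x; rewrite /= (rP x).1.
have -> : snd \o v = join (fun=> c) sg \o r by apply/funext => x; rewrite /= (rP x).2.
rewrite -!holds_rename; split=> [H|H]; last exact: aP.
by apply: contrapT => nH; apply: (aP (Not (rename r phi))).
Qed.

Lemma elem_rel_bigcup (N : structure L) (D : nat -> set (M * N)) :
    (forall n, D n `<=` D n.+1) -> D 0%N !=set0 ->
    (forall n, elem_rel (D n)) -> elem_rel (\bigcup_(n in [set: nat]) D n).
Proof.
move=> Dinc [d0 D0] De V phi v vD.
have Dle m n : (m <= n)%N -> D m `<=` D n.
  elim: n => [|n IH]; first by rewrite leqn0 => /eqP ->.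
  rewrite leq_eqVlt ltnS => /predU1P[->//|/IH mn].
  exact: subset_trans mn (Dinc n).
have [s sfin sP] := formula_support phi.
have /choice[k kP] : forall x, exists n, D n (v x).
  by move=> x; have [n _ ?] := vD x; exists n.
have [n kn] := finite_leq_bound k sfin.
(* Off the support of [phi] the values are reset to [d0], so that all of them lie in the single
   stage [D n]. *)
pose w x := if `[< D n (v x) >] then v x else d0.
have Dw x : D n (w x).
  by rewrite /w; case: asboolP => // _; exact: (Dle 0%N n).
have wv x : s x -> w x = v x.
  move=> sx; rewrite /w; case: asboolP => // -[].
  exact: Dle (kn _ sx) _ (kP x).
have -> : holds phi (fst \o v) <-> holds phi (fst \o w).
  by apply: sP => x sx /=; rewrite wv.
rewrite De //; apply: sP => x sx /=.
by rewrite wv.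
Qed.

(** Start from the restriction of [e] to [A], add the [c i] one at a time by [elem_rel_extend], and
    take the union of the stages. *)
Lemma elementary_copy (N : structure L) (e : elem_ext M N) (I : countType)
    (c : I -> N) (A : set M) : countable A -> A !=set0 ->
  exists c' : I -> M, forall (V : Type) (phi : formula L V) (v : V -> I + M),
    (forall x m, v x = inr m -> A m) ->
    holds phi (join c' id \o v) <-> holds phi (join c e \o v).
Proof.
move=> cA [m0 Am0].
pose cn n := if unpickle n is Some i then c i else e m0.
(* The choice is made for every relation at once, with the dummy [m0] for those that are not
   countable or not elementary. *)
have /choice[g gP] : forall D : set (M * N) * nat, exists m,
    countable D.1 -> elem_rel D.1 -> elem_rel (D.1 `|` [set (m, cn D.2)]).
  move=> [D n] /=; have [[cD De]|nD] := pselect (countable D /\ elem_rel D).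
    by have [m mP] := elem_rel_extend (cn n) cD De; exists m.
  by exists m0 => cD De; exfalso; exact: nD.
pose D := fix D n : set (M * N) := if n is k.+1
  then D k `|` [set (g (D k, k), cn k)] else [set (m, e m) | m in A].
have Dgood n : countable (D n) /\ elem_rel (D n).
  elim: n => [|n [cD De]]; last by split; [exact: countable_setU1|exact: (gP (D n, n))].
  split; first exact: sub_countable (card_image_le _ A) cA.
  move=> V phi v vD; rewrite (embP e).
  suff -> : e \o (fst \o v) = snd \o v by [].
  by apply/funext => x; have [m _ /= <-] := vD x.
have De : elem_rel (\bigcup_(n in [set: nat]) D n).
  apply: elem_rel_bigcup; [by move=> n x; left|by exists (m0, e m0); exists m0|].
  by move=> n; have [] := Dgood n.
exists (fun i => g (D (pickle i), pickle i)) => V phi v vA.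
set c' := (fun i : I => _).
pose w x : M * N := match v x with inl i => (c' i, c i) | inr m => (m, e m) end.
have -> : join c' id \o v = fst \o w by apply/funext => x; rewrite /w /=; case: (v x).
have -> : join c e \o v = snd \o w by apply/funext => x; rewrite /w /=; case: (v x).
apply: De => x; rewrite /w; case vE : (v x) => [i|m].
  (* [c i] is treated at stage [pickle i], so its pair first appears in the next one. *)
  by exists (pickle i).+1 => //=; right; rewrite /c' /cn pickleK.
by exists 0%N => //=; exists m => //; exact: vA vE.
Qed.

Lemma elementary_copy_formulas (N : structure L) (e : elem_ext M N)
    (I J : countType) (c : I -> N) (psi : J -> formula L (I + M)) :
  exists c' : I -> M, forall j,
    holds (psi j) (join c' id) <-> holds (psi j) (join c e).
Proof.
have [m0] := dom_inhabited M.
have /choice[s sP] : forall j, exists s : set (I + M), finite_set s /\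
    depends_on (psi j) s.
  by move=> j; have [s ? ?] := formula_support (psi j); exists s.
pose A : set M := (\bigcup_(j in [set: J]) (inr @^-1` s j)) `|` [set m0].
have cA : countable A.
  apply: countable_setU1; apply: bigcup_countable => // j _.
  apply: finite_set_countable; apply: finite_preimage; last exact: (sP j).1.
  by move=> x y _ _ [].
have Am0 : A m0 by right.
have [||c' c'P] := @elementary_copy N e I c A; [exact: cA|by exists m0|].
exists c' => j.
(* Parameters outside [A] are replaced by [m0], which does not affect any [psi j]. *)
pose r (x : I + M) : I + M := match x with
  | inl i => inl i | inr m => inr (if `[< A m >] then m else m0) end.
have rE (K : structure L) (u : I -> K) (i : M -> K) :
    holds (psi j) (join u i) <-> holds (psi j) (join u i \o r).
  apply: (sP j).2 => -[//|m] sm /=; case: asboolP => // -[].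
  by left; exists j.
rewrite [X in X <-> _]rE [X in _ <-> X]rE; apply: c'P => -[//|m] m' /= [<-].
by case: asboolP.
Qed.

(** By continuity, one formula in the type of each pair [(a i, b j)] pins [phi] down to [eps / 4]. A
    copy in [M] satisfying these countably many formulas violates stability with [eps / 2]. *)
Lemma stable_in_elem_ext (R : realType) (N : structure L) (e : elem_ext M N)
    (V W : finType) (X : formula L (V + M)) (Y : formula L (W + M))
    (phi : ctype (prodf X Y) -> R) :
  continuous phi -> stable_in (elem_id M) phi -> stable_in e phi.
Proof.
move=> cphi stM eps e0 [a [b ab]].
have e4 : 0 < eps / 4 by lra.
pose t (ij : nat * nat) := tp (ppair (a ij.1) (b ij.2)).
have /choice[th thP] : forall ij, exists th, t ij th /\
    clopen_of th `<=` [set q | `|phi (t ij) - phi q| < eps / 4].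
  move=> ij; have : nbhs (t ij) [set q | `|phi (t ij) - phi q| < eps / 4].
    exact: cvgr_dist_lt (cphi (t ij)) _ e4.
  by move=> /nbhs_clopen[th ? ?]; exists th.
pose I : countType := (nat * (V + W))%type.
pose r (ij : nat * nat) (x : (V + W) + M) : I + M := match x with
  | inl (inl v) => inl (ij.1, inl v) | inl (inr w) => inl (ij.2, inr w)
  | inr m => inr m end.
(* The conjunct [prodf X Y] keeps the copies inside [X] and [Y]. *)
pose psi (ij : nat * nat) := rename (r ij) (And (prodf X Y) (th ij)).
pose c (x : I) : N := match x.2 with
  | inl v => sval (a x.1) v | inr w => sval (b x.1) w end.
have [c' c'P] := elementary_copy_formulas e c psi.
pose a' i v := c' (i, inl v); pose b' i w := c' (i, inr w).
have cE ij : join c e \o r ij = join (sval (ppair (a ij.1) (b ij.2))) e.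
  by apply/funext => -[[]|].
have c'E ij : join c' id \o r ij = join (join (a' ij.1) (b' ij.2)) id.
  by apply/funext => -[[]|].
have ab' ij : holds (And (prodf X Y) (th ij)) (join (join (a' ij.1) (b' ij.2)) id).
  rewrite -c'E -holds_rename; apply/c'P; rewrite holds_rename cE.
  by split; [exact: (proj2_sig (ppair _ _))|exact: (thP ij).1].
have Xa i : holds X (join (a' i) id).
  by have [/prodfP[]] := ab' (i, i).
have Yb i : holds Y (join (b' i) id).
  by have [/prodfP[]] := ab' (i, i).
apply: (stM (eps / 2)); first by lra.
exists (fun i => exist _ (a' i) (Xa i)), (fun i => exist _ (b' i) (Yb i)).
move=> i j ij; rewrite leNgt; apply/negP => lt.
have close k l : `|phi (t (k, l)) - phi (tp (ppair (exist _ (a' k) (Xa k)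
    : mpts X) (exist _ (b' l) (Yb l) : mpts Y)))| < eps / 4.
  by apply: (thP (k, l)).2; exact: (ab' (k, l)).2.
have := ab i j ij; apply/negP; rewrite -ltNge.
rewrite -[tp (ppair (a i) _)]/(t (i, j)) -[tp (ppair (a j) _)]/(t (j, i)).
move: (close i j) (close j i) lt; rewrite !ltr_distl.
move=> /andP[? ?] /andP[? ?] /andP[? ?]; apply/andP; split; lra.
Qed.

End Saturation.

(** * Flows that are quotients of the type space *)

Section Flow.
Variables (R : realType) (L : language) (M : structure L) (G : defgroup M).
Variables (X : topologicalType) (act : gpts G -> X -> X) (hX : is_flow act).
Variables (pi : gtypes G -> X) (pi_continuous : continuous pi).
Hypothesis pi_surjective : forall x, exists p, pi p = x.
Hypothesis pi_equivariant : forall g p, pi (tact g p) = act g (pi p).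

Lemma Fyx_act (f : X -> R) (a b : mpts (gdom G)) :
  Fyx (f \o pi) (tp (ppair a b)) = f (act b (pi (tp a))).
Proof. by rewrite Fyx_tp_val -tact_tp /= pi_equivariant. Qed.

Lemma orbit_dense (x : X) (A : set X) :
  nbhs x A -> A `&` range (fun a : gpts G => pi (tp a)) !=set0.
Proof.
have [p <-] := pi_surjective x => /pi_continuous/tp_dense[a Aa].
by exists (pi (tp a)); split=> //; exists a.
Qed.

Lemma wap_stable (f : X -> R) : continuous f -> wap_fun act f ->
  stable_in (elem_id M) (Fyx (f \o pi)).
Proof.
move=> cf wf eps e0 [a [b ab]].
apply: (wap_double_limit (flow_continuous hX) cf (flow_compact hX) e0 wf).
exists (fun i => pi (tp (a i))), b => i j ij.
by have := ab i j ij; rewrite !Fyx_act.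
Qed.

Lemma stable_wap (f : X -> R) : continuous f ->
  stable_in (elem_id M) (Fyx (f \o pi)) -> wap_fun act f.
Proof.
move=> cf st.
apply: (double_limit_wap (flow_continuous hX) cf orbit_dense).
move=> eps e0 [x [b [xD xb]]]; apply: (st eps e0).
have /choice[a aP] : forall i, exists a : gpts G, pi (tp a) = x i.
  by move=> i; have [a _ ax] := xD i; exists a.
by exists a, b => i j ij; rewrite !Fyx_act !aP; exact: xb.
Qed.

Lemma rtrans_continuous (f : X -> R) (a : gpts G) : continuous f ->
  continuous (fun p : gtypes G => f (pi (push (rtrans_definable a) p))).
Proof.
move=> cf p; apply: (@continuous_comp _ _ _ (push _) (f \o pi)).
  exact: push_continuous.
by apply: continuous_comp; [exact: pi_continuous|exact: cf].
Qed.

(** By equivariance [act b (pi (tp a))] is the image under [pi] of the type of [b a]; hence on the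
    orbit the limit depends only on the limit type [q]. *)
Lemma act_cvg_orbit (I : Type) (U : set_system I) (b : I -> gpts G)
    (q : gtypes G) (f : X -> R) (a : gpts G) :
  Filter U -> continuous f -> (tp (b i) : gtypes G) @[i --> U] --> q ->
  f (act (b i) (pi (tp a))) @[i --> U] --> f (pi (push (rtrans_definable a) q)).
Proof.
move=> UF cf bq.
have -> : (fun i => f (act (b i) (pi (tp a)))) =
    (fun i => f (pi (push (rtrans_definable a) (tp (b i))))).
  apply/funext => i; rewrite -pi_equivariant tact_tp.
  by rewrite (push_tp_val (rtrans_definable a)).
apply: (@continuous_cvg _ _ _ _ _ (fun i => tp (b i) : gtypes G)
  (fun p => f (pi (push (rtrans_definable a) p)))) => //.
exact: rtrans_continuous.
Qed.

(* If no definable set separates A1 = {g | g x in C1} from A2 = {g | g x in C2},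
   some type q is a limit of both A1 and A2.  The two limits of the translates
   g f along ultrafilters on A1 and A2 converging to q are continuous and agree
   on the orbit pi(G(M)), which only sees q; so they agree at x. *)
Lemma wap_definable_action : wap_flow R act -> definable_action act.
Proof.
move=> wap x C1 C2 cC1 cC2 C12; apply: contrapT => nZ.
have nX := compact_normal (flow_hausdorff hX) (flow_compact hX).
have [f [cf f0 f1 _]] := urysohn_ext_itv nX cC1 cC2 C12 (@ltr01 R).
pose A1 := (act ^~ x) @^-1` C1; pose A2 := (act ^~ x) @^-1` C2.
pose def (phi : formula L ('I_(gdim G) + M)) : set (gpts G) :=
  [set g | holds phi (join (sval g) id)].
(* The traces on [A2] of the definable sets containing [A1]; an empty trace would give a separating
   definable set. *)
pose F2 := filter_from [set phi | A1 `<=` def phi] (fun phi => def phi `&` A2).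
have PF2 : ProperFilter F2.
  apply: filter_from_proper; last first.
    move=> phi A1phi; apply: contrapT => nphi; apply: nZ; exists (def phi).
    split=> //; first by exists phi.
    by move=> g A2g phig; apply: nphi; exists g.
  apply: filter_from_filter.
    by exists (gdom G) => g _; exact: (proj2_sig g).
  move=> phi psi phiA psiA; exists (And phi psi).
    by move=> g A1g; split; [exact: phiA|exact: psiA].
  by move=> g [[? ?] ?].
have [U2 [UU2 FU2]] := @ultraFilterLemma _ F2 PF2.
have [q U2q] := compact_ultralim (fun g : gpts G => tp g : gtypes G)
  (@compact_ctype _ _ _ (gdom G)) UU2.
(* The traces on [A1] of the sets defined by formulas of [q]. If [phi] in [q] missed [A1], the
   complement of [def phi] would contain [A1] and so lie in [U2], as [def phi] does. *)
pose F1 := filter_from [set phi | q phi] (fun phi => def phi `&` A1).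
have PF1 : ProperFilter F1.
  apply: filter_from_proper; last first.
    move=> phi qphi; apply: contrapT => nphi.
    have U2n : U2 (def (Not phi)).
      apply: FU2; exists (Not phi); last by move=> g [].
      by move=> g A1g phig; apply: nphi; exists g.
    have U2p : U2 (def phi) by apply: (U2q (clopen_of phi)); exact: clopen_of_nbhs.
    by have /filter_ex[g []] : U2 (def (Not phi) `&` def phi) by exact: filterI.
  apply: filter_from_filter; first by exists (gdom G); exact: ct_conc.
  move=> phi psi qphi qpsi; exists (And phi psi); first exact/ctype_and.
  by move=> g [[? ?] ?].
have [U1 [UU1 FU1]] := @ultraFilterLemma _ F1 PF1.
have U1q : (tp g : gtypes G) @[g --> U1] --> q.
  move=> A /nbhs_clopen[phi qphi phiA]; apply: FU1; exists phi => // g [gphi _].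
  exact: phiA.
have [h1 h1P] := ultralim_act act cf (flow_compact hX) id UU1.
have [h2 h2P] := ultralim_act act cf (flow_compact hX) id UU2.
have c1 := wap_ultralim_continuous UU1 (wap f cf) h1P.
have c2 := wap_ultralim_continuous UU2 (wap f cf) h2P.
have h12 (a : gpts G) : h1 (pi (tp a)) = h2 (pi (tp a)).
  have e1 := act_cvg_orbit (a := a) _ cf U1q.
  have e2 := act_cvg_orbit (a := a) _ cf U2q.
  rewrite (cvg_unique (@norm_hausdorff _ _) (h1P _) (e1 _)).
  by rewrite (cvg_unique (@norm_hausdorff _ _) (h2P _) (e2 _)).
(* Four errors of 1/8 separate the value 0 on [A1] from the value 1 on [A2], which is less than the
   gap of 1. *)
have e8 : 0 < 8^-1 :> R by lra.
have U1A : U1 A1 by apply: FU1; exists (gdom G); [exact: ct_conc|move=> g []].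
have U2A : U2 A2.
  by apply: FU2; exists (gdom G); [move=> g _; exact: (proj2_sig g)|move=> g []].
have /filter_ex[g1 [A1g1 /=]] : U1 (A1 `&` [set g | `|h1 x - f (act g x)| < 8^-1]).
  by apply: filterI => //; apply: cvgr_dist_lt (h1P x) _ e8.
have /filter_ex[g2 [A2g2 /=]] : U2 (A2 `&` [set g | `|h2 x - f (act g x)| < 8^-1]).
  by apply: filterI => //; apply: cvgr_dist_lt (h2P x) _ e8.
have -> : f (act g1 x) = 0 by apply: f0; exists (act g1 x).
have -> : f (act g2 x) = 1 by apply: f1; exists (act g2 x).
have n1 : nbhs x [set z | `|h1 x - h1 z| < 8^-1].
  exact: cvgr_dist_lt (c1 x) _ e8.
have n2 : nbhs x [set z | `|h2 x - h2 z| < 8^-1].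
  exact: cvgr_dist_lt (c2 x) _ e8.
have [w [[/= d1 d2] [a _ aw]]] := orbit_dense (filterI n1 n2).
move: d1 d2; rewrite -aw h12 !ltr_distl; clear C12 aw.
move=> /andP[? ?] /andP[? ?] /andP[? ?] /andP[? ?]; lra.
Qed.

(* A failure of stability yields b_j, a_i in G(M) whose iterated limits s (over
   a_i first) and t differ.  Definability of the type of lim a_i puts the
   condition "f(b x) is near s" into the countable type asserting that
   F(b a_i) is near lim_j F(b_j a_i); a realization b contradicts
   f(b x) = lim_i F(b a_i). *)
Lemma definable_action_stable (f : X -> R) : omega1_saturated M ->
  continuous f -> definable_action act ->
  stable_in (elem_id M) (Fyx (f \o pi)).
Proof.
move=> M_sat cf dact eps e0 [a [b ab]].
(* The final comparison passes through six errors below [d]. *)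
pose d := eps / 8; have d0 : 0 < d by rewrite /d; lra.
have [U [UU ooU]] := @ultraFilterLemma _ (\oo : set_system nat) _.
have [x Ux] := compact_ultralim (fun i => pi (tp (a i))) (flow_compact hX) UU.
have [q Uq] := compact_ultralim (fun i => tp (b i) : gtypes G)
  (@compact_ctype _ _ _ (gdom G)) UU.
have [z Uz] := compact_ultralim (fun i => act (b i) x) (flow_compact hX) UU.
have Ufz : f (act (b i) x) @[i --> U] --> f z.
  by apply: continuous_cvg => //; exact: cf.
pose t i := f (pi (push (rtrans_definable (a i)) q)).
have Ut i : f (act (b j) (pi (tp (a i)))) @[j --> U] --> t i.
  by apply: act_cvg_orbit.
have Ug (g : gpts G) : f (act g (pi (tp (a i)))) @[i --> U] --> f (act g x).
  apply: continuous_cvg; first exact: cf.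
  by apply: continuous_cvg; first exact: (flow_continuous hX).
have cdist : continuous (fun w => `|f w - f z|).
  move=> w; apply: cvg_norm; apply: cvgB; [exact: cf|exact: cvg_cst].
have closed_dist (D : set R) : closed D -> closed [set w | D `|f w - f z|].
  by apply: closed_comp => w _; exact: cdist.
(* The thresholds [d / 2] and [d] leave room between the two closed sets: [zeta] holds whenever
   [f (act g x)] is within [d / 2] of [f z], and forces it within [d]. *)
have [|||_ [[zeta ->] Z1 Z2]] := dact x [set w | `|f w - f z| <= d / 2]
    [set w | d <= `|f w - f z|].
- exact: (closed_dist _ (@closed_le _ _)).
- exact: (closed_dist _ (@closed_ge _ _)).
- by apply/seteqP; split=> // w [/= w1 w2]; lra.
have /choice[psi psiP] : forall i, exists psi, q psi /\ clopen_of psi `<=`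
    [set p : gtypes G | `|t i - f (pi (push (rtrans_definable (a i)) p))| < d].
  move=> i.
  have : nbhs q [set p | `|t i - f (pi (push (rtrans_definable (a i)) p))| < d].
    by have /cvgrPdist_lt/(_ _ d0) := @rtrans_continuous f (a i) cf q.
  by move=> /nbhs_clopen[psi ? ?]; exists psi.
(* Index 0 puts the realization in the group and near [f z]; the formulas [psi] are shifted by
   one. *)
pose Psi i := if i is k.+1 then psi k else And (gdom G) zeta.
have UPsi i : U [set j | holds (Psi i) (join (sval (b j)) id)].
  case: i => [|i] /=; last by apply: (Uq (clopen_of (psi i)));
    apply: clopen_of_nbhs; exact: (psiP i).1.
  have d2 : 0 < d / 2 by lra.
  have : U [set j | `|f z - f (act (b j) x)| < d / 2].
    exact: cvgr_dist_lt Ufz _ d2.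
  apply: filterS => j /= jz; split; first exact: (proj2_sig (b j)).
  by apply: Z1; rewrite /= distrC ltW.
have [|bM bMP] := realize_sequence M_sat (psi := Psi).
  move=> k; suff /filter_ex[j jP] : U [set j | forall i, (i <= k)%N ->
      holds (Psi i) (join (sval (b j)) id)] by exists (sval (b j)).
  elim: k => [|k IH].
    by apply: filterS (UPsi 0%N) => j j0 i; rewrite leqn0 => /eqP ->.
  apply: filterS2 IH (UPsi k.+1) => j jk jk1 i.
  by rewrite leq_eqVlt ltnS => /predU1P[->//|/jk].
pose g : gpts G := exist _ bM (bMP 0%N).1.
have gz : `|f (act g x) - f z| < d.
  by rewrite ltNge; apply/negP => /Z2; apply; exact: (bMP 0%N).2.
have gt i : `|t i - f (act g (pi (tp (a i))))| < d.
  rewrite -pi_equivariant tact_tp -(push_tp_val (rtrans_definable (a i))).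
  by apply: (psiP i).2; exact: (bMP i.+1).
(* [i] is fixed before [j], since the limits taken over [j] are those of [act (b j)] at the [i]-th
   orbit point and of [act (b i)] along the orbit points. *)
have /filter_ex[i [/= ig ib]] : U [set i |
    `|f (act g x) - f (act g (pi (tp (a i))))| < d /\
    `|f z - f (act (b i) x)| < d].
  by apply: filterI; [apply: cvgr_dist_lt (Ug g) _ d0|apply: cvgr_dist_lt Ufz _ d0].
have /filter_ex[j [/= ij [ji ji']]] : U [set j | (i < j)%N /\
    (`|t i - f (act (b j) (pi (tp (a i))))| < d /\
     `|f (act (b i) x) - f (act (b i) (pi (tp (a j))))| < d)].
  apply: filterI; first by apply: ooU; exact: nbhs_infty_gt.
  by apply: filterI;
    [apply: cvgr_dist_lt (Ut i) _ d0|apply: cvgr_dist_lt (Ug (b i)) _ d0].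
have := ab i j ij; rewrite !Fyx_act; apply/negP; rewrite -ltNge.
move: gz (gt i) ig ib ji ji'; rewrite !ltr_distl /d.
move=> /andP[? ?] /andP[? ?] /andP[? ?] /andP[? ?] /andP[? ?] /andP[? ?].
apply/andP; split; lra.
Qed.

End Flow.

Theorem theorem4p16 (R : realType) (L : language) (M : structure L)
    (hT : countable (Th M)) (G : defgroup M)
    (C : structure L) (e : elem_ext M C) (hC : monster M C)
    (X : topologicalType) (act : gpts G -> X -> X) (hX : is_flow act)
    (pi : gtypes G -> X) (pi_continuous : continuous pi)
    (pi_surjective : forall x, exists p, pi p = x)
    (pi_equivariant : forall g p, pi (tact g p) = act g (pi p)) :
  let stable_all (N : structure L) (e' : elem_ext M N) : Prop :=
    forall F : gtypes G -> R, continuous F ->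
      (exists2 f : X -> R, continuous f & F = f \o pi) ->
      stable_in e' (Fyx F) in
  let i := wap_flow R act in
  let ii := stable_all M (elem_id M) in
  let iii := definable_action act in
  ((i <-> ii) /\ (i -> iii)) /\
  (omega1_saturated M ->
     [/\ (i <-> ii), (ii <-> iii) & (ii -> stable_all C e)]).
Proof.
move=> stable_all i ii iii.
have i_ii : i <-> ii.
  split=> [wap _ _ [f cf ->]|st f cf].
    exact (wap_stable hX pi_equivariant cf (wap f cf)).
  apply: (stable_wap hX pi_continuous pi_surjective pi_equivariant cf).
  by apply: st; [move=> p; apply: continuous_comp; [exact: pi_continuous|exact: cf]
    |exists f].
have i_iii : i -> iii.
  exact (wap_definable_action hX pi_continuous pi_surjective pi_equivariant).
split=> // M_sat; split=> //.
  split=> [/i_ii/i_iii//|dact _ _ [f cf ->]].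
  exact (definable_action_stable hX pi_continuous pi_equivariant M_sat cf dact).
move=> st F cF Ff; apply: (stable_in_elem_ext M_sat).
  exact: Fyx_continuous.
exact: st.
Qed.
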